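(* For every integer $n \geq 1$ there exists a subset $A \subseteq \mathbb{R}^n$ such that $$ d_H(\mathbb{R}^n, A) = 1 \quad \text{and} \quad d_{GH}(\mathbb{R}^n, A) = \sqrt{\frac{n+1}{2n}} . $$
   Context: $\mathbb{R}^n$ carries the Euclidean metric induced by $\|\cdot\|_2$, and subsets carry the subspace metric. $d_H(X,A)$ denotes the Hausdorff distance between subsets of the ambient metric space (here, for $A\subseteq X$, it equals $\sup_{x\in X}\inf_{a\in A} d(x,a)$). The Gromov--Hausdorff distance is used in its standard, unpointed form for possibly non-compact metric spaces $X$, $Y$: $d_{GH}(X,Y)$ is the infimum of $d_H^Z(X',Y')$ over all metric spaces $Z$ and images $X',Y'\subseteq Z$ of isometric (distance-preserving) embeddings of $X$, $Y$ into $Z$. Equivalently, $d_{GH}(X,Y)=\frac12\inf_R \operatorname{dis}(R)$ over all correspondences $R\subseteq X\times Y$, i.e. relations such that every element of either set is related to some element of the other, where $\operatorname{dis}(R)=\sup\{|d_X(x,x')-d_Y(y,y')| : (x,y),(x',y')\in R\}$. *)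

(* Defs.v *)
From HB Require Import structures.
From mathcomp Require Import all_boot all_order all_algebra.
From mathcomp Require Import all_classical all_reals all_analysis.
From mathcomp Require Import ring lra.

Set Implicit Arguments.
Unset Strict Implicit.
Unset Printing Implicit Defensive.

Import Order.TTheory GRing.Theory Num.Theory.

Local Open Scope classical_set_scope.
Local Open Scope ring_scope.

(* An alias of 'rV[R]_n, so as not to meet the library's sup norm structure. *)
Definition euclidean (R : realType) (n : nat) : Type := 'rV[R]_n.

Definition enorm (R : realType) (n : nat) (x : 'rV[R]_n) : R :=
  Num.sqrt (\sum_(i < n) x 0 i ^+ 2).

Definition edist (R : realType) (n : nat) (x y : euclidean R n) : R :=
  enorm ((x : 'rV[R]_n) - (y : 'rV[R]_n)).

Section Euclidean.
Context {R : realType} {n : nat}.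
Implicit Types x y z : 'rV[R]_n.

Let sqsum_ge0 x : 0 <= \sum_(i < n) x 0 i ^+ 2.
Proof. by apply: sumr_ge0 => i _; exact: sqr_ge0. Qed.

Lemma enorm_cauchy_schwarz x y :
  \sum_(i < n) x 0 i * y 0 i <= enorm x * enorm y.
Proof.
rewrite /enorm -sqrtrM//.
apply: (le_trans (ler_norm _)); rewrite -sqrtr_sqr ler_wsqrtr//.
set a := \sum_(i < n) x 0 i ^+ 2; set b := \sum_(i < n) y 0 i ^+ 2.
set c := \sum_(i < n) _.
have a0 : 0 <= a by exact: sqsum_ge0.
have H (s t : R) : 0 <= s ^+ 2 * a - 2 * s * t * c + t ^+ 2 * b.
  rewrite /a /b /c !mulr_sumr -sumrB -big_split/=.
  apply: sumr_ge0 => i _.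
  have -> : s ^+ 2 * x 0 i ^+ 2 - 2 * s * t * (x 0 i * y 0 i) +
      t ^+ 2 * y 0 i ^+ 2 = (s * x 0 i - t * y 0 i) ^+ 2 by ring.
  exact: sqr_ge0.
have [a_eq0|a_neq0] := eqVneq a 0.
  have x0 i : x 0 i = 0.
    have /psumr_eq0P/(_ i isT)/eqP : a = 0 by [].
    by rewrite sqrf_eq0 => H0; apply/eqP; apply: H0 => j _; exact: sqr_ge0.
  rewrite /c big1 => [|i _]; last by rewrite x0 mul0r.
  by rewrite a_eq0 expr0n mul0r.
have a_gt0 : 0 < a by rewrite lt_neqAle eq_sym a_neq0.
have := H c a.
have -> : c ^+ 2 * a - 2 * c * a * c + a ^+ 2 * b = a * (a * b - c ^+ 2) by ring.
by rewrite pmulr_rge0// subr_ge0.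
Qed.

Lemma enormD x y : enorm (x + y) <= enorm x + enorm y.
Proof.
have ge0 z : 0 <= enorm z by exact: sqrtr_ge0.
rewrite -ler_sqr ?nnegrE ?addr_ge0// sqrrD !sqr_sqrtr//.
have -> : \sum_(i < n) (x + y) 0 i ^+ 2 = \sum_(i < n) x 0 i ^+ 2 +
    (\sum_(i < n) x 0 i * y 0 i) *+ 2 + \sum_(i < n) y 0 i ^+ 2.
  rewrite -sumrMnl -!big_split/=; apply: eq_bigr => i _.
  by rewrite mxE sqrrD.
by rewrite lerD2r lerD2l lerMn2r enorm_cauchy_schwarz.
Qed.

Lemma edistxx (x : euclidean R n) : edist x x = 0.
Proof.
rewrite /edist subrr /enorm big1 ?sqrtr0// => i _.
by rewrite mxE expr0n.
Qed.

Lemma edist_positivity (x y : euclidean R n) : edist x y = 0 -> x = y.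
Proof.
move=> /eqP; rewrite /edist /enorm sqrtr_eq0 => le0.
have /eqP : \sum_(i < n) ((x : 'rV[R]_n) - (y : 'rV[R]_n)) 0 i ^+ 2 = 0.
  by apply/eqP; rewrite eq_le le0 sqsum_ge0.
rewrite psumr_eq0 => [/allP xy0|i _]; last exact: sqr_ge0.
apply/rowP => i; have := xy0 i (mem_index_enum i).
by rewrite !mxE/= sqrf_eq0 subr_eq0 => /eqP.
Qed.

Lemma edist_sym (x y : euclidean R n) : edist x y = edist y x.
Proof.
rewrite /edist /enorm; congr Num.sqrt; apply: eq_bigr => i _.
by rewrite !mxE -sqrrN opprB.
Qed.

Lemma edist_triangle (y x z : euclidean R n) :
  edist x z <= edist x y + edist y z.
Proof.
rewrite /edist; apply: le_trans (enormD _ _).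
by rewrite addrA subrK.
Qed.

HB.instance Definition _ := Choice.copy (euclidean R n) 'rV[R]_n.
HB.instance Definition _ := isMetric.Build R (euclidean R n)
  edistxx edist_positivity edist_sym edist_triangle.

Lemma edistE (x y : euclidean R n) :
  mdist x y = Num.sqrt (\sum_(i < n) (x 0 i - y 0 i) ^+ 2).
Proof.
by congr Num.sqrt; apply: eq_bigr => i _; rewrite !mxE.
Qed.

End Euclidean.

(* A subset with the restricted distance.  An alias of set_type A, on which
   the library already puts the (propositionally equal) initial topology. *)
Definition metric_subspace (R : realType) (X : metricType R) (A : set X) : Type :=
  set_type A.

Section MetricSubspace.
Context {R : realType} {X : metricType R} {A : set X}.

Definition subspace_dist (x y : metric_subspace A) : R :=
  mdist (set_val x) (set_val y).

Lemma subspace_distxx x : subspace_dist x x = 0.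
Proof. exact: mdistxx. Qed.

Lemma subspace_dist_positivity x y : subspace_dist x y = 0 -> x = y.
Proof. by move/mdist_positivity/val_inj. Qed.

Lemma subspace_dist_sym x y : subspace_dist x y = subspace_dist y x.
Proof. exact: metric_sym. Qed.

Lemma subspace_dist_triangle y x z :
  subspace_dist x z <= subspace_dist x y + subspace_dist y z.
Proof. exact: metric_triangle. Qed.

HB.instance Definition _ := Choice.copy (metric_subspace A) (set_type A).
HB.instance Definition _ := isMetric.Build R (metric_subspace A)
  subspace_distxx subspace_dist_positivity subspace_dist_sym
  subspace_dist_triangle.

Lemma subspace_distE (x y : metric_subspace A) :
  mdist x y = mdist (set_val x) (set_val y).
Proof. by []. Qed.

End MetricSubspace.

Local Open Scope ereal_scope.

Definition dist_to_set (R : realType) (Z : metricType R) (x : Z) (A : set Z) :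
  \bar R := ereal_inf [set (mdist x a)%:E | a in A].

(* +oo when exactly one of A, B is empty; degenerate (-oo) when both are. *)
Definition hausdorff_dist (R : realType) (Z : metricType R) (A B : set Z) :
  \bar R :=
  maxe (ereal_sup [set dist_to_set a B | a in A])
       (ereal_sup [set dist_to_set b A | b in B]).

Definition isometric_embedding (R : realType) (X Z : metricType R)
  (f : X -> Z) : Prop := forall x y, mdist (f x) (f y) = mdist x y.

Definition gromov_hausdorff_dist (R : realType) (X Y : metricType R) :
  \bar R :=
  ereal_inf [set e | exists (Z : metricType R) (f : X -> Z) (g : Y -> Z),
    [/\ isometric_embedding f, isometric_embedding g &
        e = hausdorff_dist (range f) (range g)]].

(* Main.v *)
(** Let v_0, ..., v_n be the vertices of a regular simplex inscribed in the unit
    sphere, C_i the cone of the points x maximizing <x, v_i> over i, and A the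
    union of the translates C_i + v_i.  Since <x, v_i> >= 0 on C_i, every point
    of A has norm at least 1, while x in C_i is at distance 1 from x + v_i: the
    Hausdorff distance is 1.  Relating x in C_i to x + v_i changes distances by
    at most the edge length s of the simplex, so the Gromov-Hausdorff distance
    is at most s / 2, which is the claimed value.  Conversely two points of A
    in different translates are at distance at least s, whereas R^n is
    connected, so no correspondence has distortion less than s. *)
From HB Require Import structures.
Require Import Defs.
From mathcomp Require Import all_boot all_order all_algebra.
From mathcomp Require Import all_classical all_reals all_analysis.
From mathcomp Require Import ring lra.

Set Implicit Arguments.
Unset Strict Implicit.
Unset Printing Implicit Defensive.

Import Order.TTheory GRing.Theory Num.Theory.

Local Open Scope classical_set_scope.
Local Open Scope ring_scope.

(** * Gluing two metric spaces along a correspondence of bounded distortion *)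

Section Gluing.
Context {R : realType} {X Y : metricType R}.
Variables (C : X -> Y -> Prop) (r : R).
Hypothesis r_gt0 : 0 < r.
Hypothesis totalX : forall x, exists y, C x y.
Hypothesis disC : forall x x' y y', C x y -> C x' y' ->
  `|mdist x x' - mdist y y'| <= 2 * r.

(* The largest metric on the disjoint union that extends both metrics and puts
   related points at distance at most r. *)
Definition glued_cross (x : X) (y : Y) : R :=
  inf [set t | exists x' y', C x' y' /\ t = mdist x x' + r + mdist y' y].

Definition glued_dist (u v : X + Y) : R :=
  match u, v with
  | inl x, inl x' => mdist x x'
  | inr y, inr y' => mdist y y'
  | inl x, inr y => glued_cross x y
  | inr y, inl x => glued_cross x y
  end.

Lemma le_glued_cross x y t :
  (forall x' y', C x' y' -> t <= mdist x x' + r + mdist y' y) ->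
  t <= glued_cross x y.
Proof.
move=> ht; apply: lb_le_inf; last by move=> _ [x' [y' [c ->]]]; exact: ht.
(* Totality makes the set nonempty; on the empty set [inf] would take the default value 0. *)
by have [y' c] := totalX x; exists (mdist x x + r + mdist y' y), x, y'.
Qed.

Lemma glued_cross_le x y x' y' : C x' y' ->
  glued_cross x y <= mdist x x' + r + mdist y' y.
Proof.
move=> c; apply: ge_inf; last by exists x', y'.
exists 0 => _ [x1 [y1 [_ ->]]].
by rewrite !addr_ge0 ?mdist_ge0// ltW.
Qed.

Lemma glued_cross_gt0 x y : 0 < glued_cross x y.
Proof.
apply: (lt_le_trans r_gt0); apply: le_glued_cross => x' y' _.
by have := mdist_ge0 x x'; have := mdist_ge0 y' y; lra.
Qed.

Lemma glued_cross_related x y : C x y -> glued_cross x y <= r.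
Proof. by move/(glued_cross_le x y); rewrite !mdistxx add0r addr0. Qed.

Lemma glued_distxx u : glued_dist u u = 0.
Proof. by case: u => u /=; rewrite mdistxx. Qed.

Lemma glued_dist_positivity u v : glued_dist u v = 0 -> u = v.
Proof.
case: u v => [x|y] [x'|y'] //=.
- by move/mdist_positivity ->.
- by move/eqP; rewrite gt_eqF// glued_cross_gt0.
- by move/eqP; rewrite gt_eqF// glued_cross_gt0.
- by move/mdist_positivity ->.
Qed.

Lemma glued_dist_sym u v : glued_dist u v = glued_dist v u.
Proof. by case: u v => [x|y] [x'|y'] //=; exact: metric_sym. Qed.

Lemma glued_dist_triangle v u w :
  glued_dist u w <= glued_dist u v + glued_dist v w.
Proof.
case: u v w => [x|y] [x1|y1] [x2|y2] /=; try exact: metric_triangle.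
- rewrite -lerBlDl; apply: le_glued_cross => x' y' c.
  have := glued_cross_le x y2 c; have := metric_triangle x x1 x'; lra.
(* Crossing over and back costs [2 * r], which absorbs the distortion between the related pairs [c]
   and [c']. *)
- rewrite -lerBlDr; apply: le_glued_cross => x' y' c.
  rewrite lerBlDr addrC -lerBlDr; apply: le_glued_cross => x'' y'' c'.
  have := disC c c'; rewrite ler_norml => /andP[_].
  have := metric_triangle x x' x2; have := metric_triangle x' x'' x2.
  have := metric_triangle y' y1 y''.
  rewrite (metric_sym x'' x2) (metric_sym y1 y''); lra.
- rewrite -lerBlDr; apply: le_glued_cross => x' y' c.
  have := glued_cross_le x y2 c; have := metric_triangle y' y1 y2; lra.
- rewrite -lerBlDr; apply: le_glued_cross => x' y' c.
  have := glued_cross_le x2 y c; have := metric_triangle x2 x1 x'.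
  rewrite (metric_sym x2 x1); lra.
- rewrite -lerBlDr; apply: le_glued_cross => x' y' c.
  rewrite lerBlDr addrC -lerBlDr; apply: le_glued_cross => x'' y'' c'.
  have := disC c c'; rewrite ler_norml => /andP[+ _].
  have := metric_triangle y y' y2; have := metric_triangle y' y'' y2.
  have := metric_triangle x' x1 x''.
  rewrite (metric_sym x' x1) (metric_sym y y'); lra.
- rewrite -lerBlDl; apply: le_glued_cross => x' y' c.
  have := glued_cross_le x2 y c; have := metric_triangle y' y1 y.
  rewrite (metric_sym y y1); lra.
Qed.

End Gluing.

(* An alias without the library's topology on sums. *)
Definition glued (X Y : Type) : Type := (X + Y)%type.
HB.instance Definition _ (X Y : choiceType) :=
  Choice.copy (glued X Y) (X + Y)%type.

(** * Bounds on the Hausdorff distance *)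

Section HausdorffBounds.
Context {R : realType} {Z : metricType R}.
Implicit Types (A B : set Z) (x : Z) (r : R).

Lemma dist_to_set_le x a r A : A a -> mdist x a <= r ->
  (dist_to_set x A <= r%:E)%E.
Proof.
move=> Aa xar; apply: (@le_trans _ _ (mdist x a)%:E); last by rewrite lee_fin.
by apply: ereal_inf_lbound; exists a.
Qed.

Lemma hausdorff_dist_le A B r :
  (forall a, A a -> exists2 b, B b & mdist a b <= r) ->
  (forall b, B b -> exists2 a, A a & mdist b a <= r) ->
  (hausdorff_dist A B <= r%:E)%E.
Proof.
move=> hA hB; rewrite /hausdorff_dist ge_max; apply/andP; split.
- apply: ge_ereal_sup => _ [a Aa <-].
  by have [b Bb ab] := hA a Aa; exact: dist_to_set_le Bb ab.
- apply: ge_ereal_sup => _ [b Bb <-].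
  by have [a Aa ab] := hB b Bb; exact: dist_to_set_le Aa ab.
Qed.

Lemma hausdorff_dist_ltl A B r a : (hausdorff_dist A B < r%:E)%E -> A a ->
  exists2 b, B b & mdist a b < r.
Proof.
rewrite /hausdorff_dist gt_max => /andP[hAB _] Aa.
have : (dist_to_set a B < r%:E)%E.
  by apply: le_lt_trans hAB; apply: ereal_sup_ubound; exists a.
by case/ereal_inf_lt => _ [b Bb <-]; rewrite lte_fin; exists b.
Qed.

Lemma hausdorff_distC A B : hausdorff_dist A B = hausdorff_dist B A.
Proof. by rewrite /hausdorff_dist maxC. Qed.

End HausdorffBounds.

(** * Upper and lower bounds on the Gromov-Hausdorff distance *)

Section GromovHausdorffBounds.
Context {R : realType} {X Y : metricType R}.

Lemma gromov_hausdorff_le_correspondence (C : X -> Y -> Prop) (r : R) :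
  0 < r -> (forall x, exists y, C x y) -> (forall y, exists x, C x y) ->
  (forall x x' y y', C x y -> C x' y' ->
    `|mdist x x' - mdist y y'| <= 2 * r) ->
  (gromov_hausdorff_dist X Y <= r%:E)%E.
Proof.
move=> r0 tX tY dC.
(* The metric depends on [C], [r] and the hypotheses, so its structure is packed locally. *)
pose M := isMetric.Build R (glued X Y) (@glued_distxx _ _ _ C r)
  (glued_dist_positivity r0 tX) (@glued_dist_sym _ _ _ C r)
  (glued_dist_triangle r0 tX dC).
pose Z : metricType R := HB.pack (glued X Y) M.
apply: (@le_trans _ _
  (hausdorff_dist (range (inl : X -> Z)) (range (inr : Y -> Z)))).
  by apply: ereal_inf_lbound; exists Z, inl, inr; split.
apply: hausdorff_dist_le => [_ [x _ <-]|_ [y _ <-]].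
- have [y c] := tX x; exists (inr y); first by exists y.
  exact: glued_cross_related.
- have [x c] := tY y; exists (inl x); first by exists x.
  exact: glued_cross_related.
Qed.

(** Finite chains with steps shorter than any [d] join any two points, phrased as an induction
    principle over such steps. *)
Definition chain_connected (T : metricType R) : Prop :=
  forall (U : set T) (d : R), 0 < d ->
    (forall x y, U x -> mdist x y < d -> U y) ->
    forall x y, U x -> U y.

(* If the images are within t < s/2 of each other, being close to B is
   preserved along steps of length less than s - 2t in X. *)
Lemma gromov_hausdorff_ge_separated (B : set Y) (s : R) (b0 b1 : Y) :
  chain_connected X -> B b0 -> ~ B b1 ->
  (forall b b', B b -> ~ B b' -> s <= mdist b b') ->
  ((s / 2)%:E <= gromov_hausdorff_dist X Y)%E.
Proof.
move=> cX Bb0 nBb1 sep; apply: le_ereal_inf_tmp => _ [Z [f [g [isof isog ->]]]].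
rewrite leNgt; apply/negP => hlt.
(* The strict gap below [s / 2] leaves a positive step length [s - 2 * t]. *)
have [t hlt' t2] : exists2 t : R,
    (hausdorff_dist (range f) (range g) < t%:E)%E & t < s / 2.
  case: (hausdorff_dist _ _) hlt => [h| |] // hlt.
  - move: hlt; rewrite lte_fin => hlt; exists ((h + s / 2) / 2); last by lra.
    by rewrite lte_fin; lra.
  - by exists (s / 2 - 1); [rewrite ltNyr|lra].
have nearX x : exists b, mdist (f x) (g b) < t.
  have [|_ [b _ <-] ?] := hausdorff_dist_ltl hlt' (a := f x); first by exists x.
  by exists b.
have nearY b : exists x, mdist (f x) (g b) < t.
  rewrite hausdorff_distC in hlt'.
  have [|_ [x _ <-] ?] := hausdorff_dist_ltl hlt' (a := g b); first by exists b.
  by exists x; rewrite metric_sym.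
pose U := [set x | exists2 b, B b & mdist (f x) (g b) < t].
have stepU x y : U x -> mdist x y < s - 2 * t -> U y.
  move=> [b Bb xb] xy; have [b' yb'] := nearX y; exists b' => //.
  (* Otherwise the route from [g b] via [f x] and [f y] to [g b'] is shorter than
     [t + (s - 2 * t) + t = s]. *)
  apply: contrapT => nBb'; have := sep _ _ Bb nBb'.
  rewrite -isog; have := metric_triangle (g b) (f x) (g b').
  have := metric_triangle (f x) (f y) (g b').
  rewrite isof (metric_sym (g b) (f x)).
  by lra.
have [x0 x0b0] := nearY b0; have [x1 x1b1] := nearY b1.
have Ux0 : U x0 by exists b0.
have d0 : 0 < s - 2 * t by lra.
have [b Bb x1b] := cX U _ d0 stepU x0 x1 Ux0.
have := sep _ _ Bb nBb1; rewrite -isog.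
have := metric_triangle (g b) (f x1) (g b1).
by rewrite (metric_sym (g b) (f x1)); lra.
Qed.

End GromovHausdorffBounds.

(** * The Euclidean inner product, and chains along segments *)

Section DotProduct.
Context {R : realType} {n : nat}.
Implicit Types x y z : 'rV[R]_n.

Definition dot x y : R := \sum_(i < n) x 0 i * y 0 i.

Lemma dotC x y : dot x y = dot y x.
Proof. by apply: eq_bigr => i _; rewrite mulrC. Qed.

Lemma dotDl x y z : dot (x + y) z = dot x z + dot y z.
Proof. by rewrite -big_split; apply: eq_bigr => i _; rewrite mxE mulrDl. Qed.

Lemma dotZl a x y : dot (a *: x) y = a * dot x y.
Proof. by rewrite mulr_sumr; apply: eq_bigr => i _; rewrite mxE mulrA. Qed.

Lemma dotNl x y : dot (- x) y = - dot x y.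
Proof. by rewrite -scaleN1r dotZl mulN1r. Qed.

Lemma dotDr x y z : dot z (x + y) = dot z x + dot z y.
Proof. by rewrite !(dotC z) dotDl. Qed.

Lemma dotNr x y : dot x (- y) = - dot x y.
Proof. by rewrite !(dotC x) dotNl. Qed.

Lemma dot0l x : dot 0 x = 0.
Proof. by apply: big1 => i _; rewrite mxE mul0r. Qed.

Lemma dot_sumr I (s : seq I) (F : I -> 'rV[R]_n) x :
  dot x (\sum_(i <- s) F i) = \sum_(i <- s) dot x (F i).
Proof.
by elim/big_ind2 : _ => // [|_ y _ z <- <-]; [rewrite dotC dot0l|rewrite dotDr].
Qed.

Lemma dot_ge0 x : 0 <= dot x x.
Proof. by apply: sumr_ge0 => i _; rewrite -expr2 sqr_ge0. Qed.

Lemma enormE x : enorm x = Num.sqrt (dot x x).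
Proof. by congr Num.sqrt; apply: eq_bigr => i _; rewrite expr2. Qed.

Lemma enormN x : enorm (- x) = enorm x.
Proof. by rewrite !enormE dotNl dotNr opprK. Qed.

Lemma enormZ a x : enorm (a *: x) = `|a| * enorm x.
Proof.
by rewrite !enormE dotZl dotC dotZl mulrA -expr2 sqrtrM ?sqr_ge0// sqrtr_sqr.
Qed.

Lemma mdist_enorm (x y : euclidean R n) :
  mdist x y = enorm ((x : 'rV[R]_n) - (y : 'rV[R]_n)).
Proof. by []. Qed.

Lemma enorm_dist x y : `|enorm x - enorm y| <= enorm (x - y).
Proof.
rewrite ler_norml; apply/andP; split.
- have := enormD x (y - x); rewrite addrC subrK.
  by rewrite -(enormN (y - x)) opprB; lra.
- by have := enormD y (x - y); rewrite addrC subrK; lra.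
Qed.

Lemma euclidean_chain_connected : chain_connected (euclidean R n).
Proof.
move=> U d d0 stepU x y Ux.
pose u : 'rV[R]_n := (y : 'rV[R]_n) - (x : 'rV[R]_n).
(* Cutting the segment into [N] equal steps makes each shorter than [d]. *)
have [N hN] : exists N : nat, enorm u / d < N%:R.
  exists (Num.truncn (enorm u / d)).+1; exact: truncnS_gt.
have N0 : 0 < (N%:R : R).
  by apply: le_lt_trans hN; rewrite divr_ge0 ?sqrtr_ge0// ltW.
pose p k : euclidean R n := (x : 'rV[R]_n) + (k%:R / N%:R) *: u.
have Up k : U (p k).
  elim: k => [|k IHk]; first by rewrite /p mul0r scale0r addr0.
  apply: (stepU _ _ IHk).
  have -> : mdist (p k) (p k.+1) = enorm (- (N%:R^-1 *: u)).
    rewrite mdist_enorm /p; congr enorm.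
    rewrite opprD addrACA subrr add0r -scalerBl -[in RHS]scaleNr.
    by congr (_ *: _); rewrite -natr1; ring.
  rewrite enormN enormZ ger0_norm ?invr_ge0 ?ltW//.
  by rewrite mulrC ltr_pdivrMr// mulrC -ltr_pdivrMr.
have -> // : y = p N.
by rewrite /p divff ?gt_eqF// scale1r addrC subrK.
Qed.

End DotProduct.

(** * The regular simplex, its cells and their translates *)

Section Simplex.
Context {R : realType} {n : nat}.
Hypothesis n_gt0 : (0 < n)%N.

(* v_n is proportional to (1, ..., 1) and v_i, for i < n, differs from
   a multiple of the i-th basis vector by a multiple of (1, ..., 1). *)
Definition simplex_vertex (i : 'I_n.+1) : 'rV[R]_n :=
  let a : R := Num.sqrt ((n%:R + 1) / n%:R) in
  let c : R := (Num.sqrt n%:R)^-1 in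
  \row_j (a * (i == j :> nat)%:R +
          (if i == n :> nat then - c else (c - a) / n%:R)).

Let natn_gt0 : 0 < n%:R :> R. Proof. by rewrite ltr0n. Qed.

Lemma simplex_vertex_sum : \sum_i simplex_vertex i = 0.
Proof.
apply/rowP => j; rewrite summxE [RHS]mxE.
under eq_bigr do rewrite mxE.
rewrite big_split/= -mulr_sumr big_ord_recr/= gtn_eqF// addr0.
rewrite (bigD1 j)//= eqxx big1 ?addr0; last first.
  by move=> i; rewrite -val_eqE/= => /negPf ->.
rewrite big_ord_recr/= eqxx.
under eq_bigr => i _ do rewrite ltn_eqF//.
rewrite sumr_const card_ord -[X in _ + (X - _)]mulr_natr.
by field; rewrite !gt_eqF ?sqrtr_gt0.
Qed.

(** The Gram matrix of a regular simplex in the unit sphere; it results from [a ^+ 2 = 1 + 1 / n]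
    and [c ^+ 2 = 1 / n]. *)
Lemma simplex_vertex_dot i j :
  dot (simplex_vertex i) (simplex_vertex j) = if i == j then 1 else - n%:R^-1.
Proof.
rewrite /dot; under eq_bigr do rewrite !mxE.
set a := Num.sqrt ((n%:R + 1) / n%:R); set c := (Num.sqrt n%:R)^-1.
have a2 : a ^+ 2 = 1 + n%:R^-1.
  rewrite sqr_sqrtr ?divr_ge0 ?addr_ge0 ?ltW//.
  by field; rewrite gt_eqF.
have c2 : c ^+ 2 = n%:R^-1 by rewrite exprVn sqr_sqrtr// ltW.
set b := (c - a) / n%:R.
have sum1 (k : 'I_n.+1) :
    \sum_(l < n) (k == l :> nat)%:R = (k != n :> nat)%:R :> R.
  have [kn|nkn] := eqVneq (k : nat) n.
    by rewrite kn big1// => l _; rewrite gtn_eqF.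
  have kn : (k < n)%N by rewrite ltn_neqAle nkn -ltnS ltn_ord.
  rewrite (bigD1 (Ordinal kn))//= eqxx big1 ?addr0// => l.
  by rewrite -val_eqE/= eq_sym => /negPf ->.
have expand (bi bj : R) :
    \sum_(l < n) (a * (i == l :> nat)%:R + bi) * (a * (j == l :> nat)%:R + bj) =
    a ^+ 2 * ((i == j) && (i != n :> nat))%:R + a * bj * (i != n :> nat)%:R +
    a * bi * (j != n :> nat)%:R + n%:R * bi * bj.
  have -> : ((i == j) && (i != n :> nat))%:R =
      \sum_(l < n) (i == l :> nat)%:R * (j == l :> nat)%:R :> R.
    have [<-|ij] := eqVneq i j.
      by rewrite -sum1; apply: eq_bigr => l _; rewrite -natrM mulnb andbb.
    rewrite big1// => l _; rewrite -natrM mulnb; case: eqP => // <-.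
    by rewrite eq_sym val_eqE (negPf ij).
  rewrite -!sum1 !mulr_sumr.
  have -> : n%:R * bi * bj = \sum_(l < n) bi * bj.
    by rewrite sumr_const card_ord -[RHS]mulr_natl mulrA.
  rewrite -!big_split; apply: eq_bigr => l _ /=; ring.
rewrite expand; have n0 : n%:R != 0 :> R by rewrite gt_eqF.
have nb : n%:R * b = c - a by rewrite /b mulrC divfK.
(* [key] is the product of two distinct vertices other than the last, [key2] minus the product of
   such a vertex with the last, [nc2] the squared norm of the last. *)
have key : n%:R * b ^+ 2 + 2 * a * b = - n%:R^-1.
  have -> : n%:R * b ^+ 2 + 2 * a * b = (n%:R * b + 2 * a) * b by ring.
  rewrite nb /b mulrA.
  have -> : (c - a + 2 * a) * (c - a) = c ^+ 2 - a ^+ 2 by ring.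
  by rewrite a2 c2; field.
have key2 : (a + n%:R * b) * c = n%:R^-1.
  by rewrite nb -c2; ring.
have nc2 : n%:R * c ^+ 2 = 1 by rewrite c2 divff.
have ijn : (j == n :> nat) && (i == n :> nat) -> i = j.
  by case/andP => /eqP jn /eqP ini; apply: val_inj; rewrite /= jn.
have [ij|ij] := eqVneq i j.
  subst j; case: (eqVneq (i : nat) n) => _; rewrite /= ?mulr0 ?mulr1.
    by rewrite -[RHS]nc2; ring.
  by rewrite -[RHS](addrK n%:R^-1) -a2 -key; ring.
case: (eqVneq (i : nat) n) => [iN|_]; case: (eqVneq (j : nat) n) => [jN|_] /=;
  rewrite ?mulr0 ?mulr1.
- by move: ij; rewrite -val_eqE/= iN jN eqxx.
- by rewrite -[in RHS]key2; ring.
- by rewrite -[in RHS]key2; ring.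
- by rewrite -[RHS]key; ring.
Qed.

Local Notation v := simplex_vertex.
Local Notation r := (Num.sqrt ((n%:R + 1) / (2 * n%:R)) : R).

Lemma simplex_vertex_norm i : enorm (v i) = 1.
Proof. by rewrite enormE simplex_vertex_dot eqxx sqrtr1. Qed.

Lemma half_edge_gt0 : 0 < r.
Proof. by rewrite sqrtr_gt0 divr_gt0 ?addr_gt0 ?mulr_gt0. Qed.

(** By the Gram matrix the squared edge is [2 + 2 / n], so [r] is half an edge. *)
Lemma simplex_edge_sqr i j : i != j ->
  dot (v i - v j) (v i - v j) = (2 * r) ^+ 2.
Proof.
move=> ij; rewrite dotDl !dotDr !dotNl !dotNr !simplex_vertex_dot !eqxx.
rewrite (eq_sym j) (negPf ij) exprMn sqr_sqrtr; last first.
  by rewrite divr_ge0 ?addr_ge0 ?mulr_ge0 ?ltW.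
by field; rewrite gt_eqF.
Qed.

Lemma simplex_edge_le i j : enorm (v i - v j) <= 2 * r.
Proof.
have r0 := half_edge_gt0; have [->|ij] := eqVneq i j.
  by rewrite subrr enormE dot0l sqrtr0 mulr_ge0// ltW.
by rewrite enormE simplex_edge_sqr// sqrtr_sqr ger0_norm// mulr_ge0// ltW.
Qed.

(** The vertices having equal norms, this is the Voronoi cell of [v i]. *)
Definition simplex_cell (i : 'I_n.+1) : set 'rV[R]_n :=
  [set x | forall j, dot x (v j) <= dot x (v i)].

Lemma simplex_cell_cover x : exists i, simplex_cell i x.
Proof.
have [i _ hi] := @Order.TotalTheory.arg_maxP _ _ _ (ord0 : 'I_n.+1) xpredT
  (fun i => dot x (v i)) isT.
by exists i => j; exact: hi.
Qed.

Lemma simplex_cell0 i : simplex_cell i 0.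
Proof. by move=> j; rewrite !dot0l. Qed.

(* The inner products with the vertices sum to 0, so the largest is
   nonnegative. *)
Lemma simplex_cell_dot_ge0 i x : simplex_cell i x -> 0 <= dot x (v i).
Proof.
move=> xi; have : \sum_j dot x (v j) <= \sum_(j < n.+1) dot x (v i).
  by apply: ler_sum => j _; exact: xi.
rewrite -dot_sumr simplex_vertex_sum dotC dot0l sumr_const card_ord.
by rewrite pmulrn_lge0.
Qed.

Lemma shifted_cell_enorm_ge1 i x : simplex_cell i x -> 1 <= enorm (x + v i).
Proof.
move=> /simplex_cell_dot_ge0 xi.
rewrite -sqrtr1 enormE ler_wsqrtr// dotDl !dotDr simplex_vertex_dot eqxx.
by rewrite (dotC (v i)); have := dot_ge0 x; lra.
Qed.

(** The cross term [dot (x - y) (v i - v j)] is nonnegative, since [x] favours [v i] and [y] favours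
    [v j]; hence shifting only widens the edge [v i - v j]. *)
Lemma shifted_cells_separated i j x y : i != j ->
  simplex_cell i x -> simplex_cell j y ->
  2 * r <= enorm ((x + v i) - (y + v j)).
Proof.
move=> ij xi yj.
have r0 : 0 <= 2 * r by rewrite mulr_ge0 ?sqrtr_ge0.
rewrite -(ger0_norm r0) -sqrtr_sqr enormE ler_wsqrtr//.
rewrite -(simplex_edge_sqr ij) opprD addrACA.
rewrite (dotDl (x - y)) !(dotDr (x - y)) (dotC (v i - v j) (x - y)).
have : 0 <= dot (x - y) (v i - v j).
  rewrite dotDl !dotDr !dotNl !dotNr; have := xi j; have := yj i; lra.
by have := dot_ge0 (x - y); lra.
Qed.

Definition shifted_cells : set (euclidean R n) :=
  [set a | exists i, exists2 x, simplex_cell i x & a = x + v i].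

Lemma shifted_cells_hausdorff :
  hausdorff_dist [set: euclidean R n] shifted_cells = 1%:E.
Proof.
have d1 (x : 'rV[R]_n) i : mdist (x : euclidean R n) (x + v i) = 1.
  by rewrite mdist_enorm opprD addNKr enormN simplex_vertex_norm.
apply/eqP; rewrite eq_le; apply/andP; split.
  apply: hausdorff_dist_le => [x _|a _]; last first.
    by exists a => //; rewrite mdistxx.
  have [i xi] := simplex_cell_cover x.
  by exists (x + v i); [exists i, x|rewrite d1].
(* The origin attains the lower bound, as all of [shifted_cells] has norm at least 1. *)
pose z : euclidean R n := (0 : 'rV[R]_n).
apply: (@le_trans _ _ (dist_to_set z shifted_cells)).
  apply: le_ereal_inf_tmp => _ [_ [i [x xi ->]] <-].
  rewrite lee_fin mdist_enorm sub0r enormN.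
  exact: shifted_cell_enorm_ge1.
rewrite /hausdorff_dist le_max; apply/orP; left.
by apply: ereal_sup_ubound; exists z.
Qed.

Lemma shifted_cells_gromov_hausdorff_le :
  (gromov_hausdorff_dist (euclidean R n) (metric_subspace shifted_cells)
    <= r%:E)%E.
Proof.
(* A relation rather than a map: a point common to several cells has several translates. *)
pose C (x : euclidean R n) (a : metric_subspace shifted_cells) :=
  exists2 i, simplex_cell i x & set_val a = (x : 'rV[R]_n) + v i.
apply: (gromov_hausdorff_le_correspondence (C := C) half_edge_gt0).
- move=> x; have [i xi] := simplex_cell_cover x.
  have xA : shifted_cells ((x : 'rV[R]_n) + v i) by exists i, x.
  by exists (SigSub (mem_set xA)), i.
- case=> a aA; have [i [x xi ax]] := set_mem aA.
  by exists x, i.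
- move=> x x' a a' [i _ ai] [j _ aj].
  rewrite subspace_distE ai aj !mdist_enorm.
  (* By the reverse triangle inequality only the difference of the two shifts remains. *)
  apply: le_trans (enorm_dist _ _) _.
  have -> : (x : 'rV[R]_n) - x' - (x + v i - (x' + v j)) = v j - v i.
    by apply/rowP => k; rewrite !mxE; ring.
  exact: simplex_edge_le.
Qed.

Lemma shifted_cells_gromov_hausdorff_ge :
  (r%:E <= gromov_hausdorff_dist (euclidean R n)
    (metric_subspace shifted_cells))%E.
Proof.
have vA i : shifted_cells (v i).
  by exists i, 0; [exact: simplex_cell0|rewrite add0r].
pose p i : metric_subspace shifted_cells := SigSub (mem_set (vA i)).
pose B : set (metric_subspace shifted_cells) :=
  [set a | exists2 x, simplex_cell ord0 x & set_val a = x + v ord0].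
have sep a b : B a -> ~ B b -> 2 * r <= mdist a b.
  move=> [x x0 ax] nB; have [i [y yi bY]] : shifted_cells (set_val b).
    exact: set_valP.
  rewrite subspace_distE ax bY mdist_enorm.
  apply: shifted_cells_separated => //.
  by apply: contra_notN nB => /eqP i0; exists y; rewrite ?i0.
have Bp0 : B (p ord0).
  by exists 0; [exact: simplex_cell0|rewrite add0r].
have nBp1 : ~ B (p ord_max).
  move=> [x x0 /= vx].
  have m0 : (ord0 : 'I_n.+1) != ord_max by rewrite -val_eqE/= eq_sym -lt0n.
  (* A point in two different translates would be at distance at least [2 * r > 0] from itself. *)
  have := shifted_cells_separated m0 x0 (simplex_cell0 ord_max).
  rewrite add0r -vx subrr enormE dot0l sqrtr0.
  by have := half_edge_gt0; lra.
have -> : r = 2 * r / 2 by field.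
exact: gromov_hausdorff_ge_separated euclidean_chain_connected Bp0 nBp1 sep.
Qed.

End Simplex.

Theorem theorem3p1 (R : realType) (n : nat) (hn : (1 <= n)%N) :
  exists A : set (euclidean R n),
    hausdorff_dist [set: euclidean R n] A = 1%:E /\
    gromov_hausdorff_dist (euclidean R n) (metric_subspace A) =
      (Num.sqrt ((n%:R + 1) / (2 * n%:R)))%:E.
Proof.
exists (shifted_cells (R := R) (n := n)); split.
  exact: shifted_cells_hausdorff.
apply/eqP; rewrite eq_le shifted_cells_gromov_hausdorff_le//=.
exact: shifted_cells_gromov_hausdorff_ge.
Qed.
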